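(* For the lattice Boltzmann scheme with relative velocities described in the context, the mass and momentum satisfy, as $\Delta\to0$, $$\partial_t\rho+\sum_\beta\partial_\beta q^\beta=\mathcal{O}(\Delta^2),$$ $$\partial_t q^\alpha+\sum_\beta\partial_\beta F^{\alpha\beta}-\Delta\Big(\sum_{\beta,\;l>d}\sigma_l\,\partial_\beta\big(\Lambda_{\alpha\beta}^{l}(\widetilde u)\,\theta_l(\widetilde u)\big)\Big)=\mathcal{O}(\Delta^2),\qquad 1\le\alpha\le d,$$ where $F^{\alpha\beta}=\sum_j v_j^\alpha v_j^\beta f_j^{\rm eq}$, $\sigma_l=\frac1{s_l}-\frac12$, $\theta_l(\widetilde u)=\sum_j M_{lj}(\widetilde u)\,\mathrm{d}_t^j f_j^{\rm eq}$ with $\mathrm{d}_t^j=\partial_t+\sum_\gamma v_j^\gamma\partial_\gamma$, and $\Lambda_{\alpha\beta}^l(\widetilde u)=\sum_j v_j^\alpha v_j^\beta\,(M(\widetilde u)^{-1})_{jl}$.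
   Context: **Scheme.** Let $d\ge1$, $q\geq d+1$ be integers, $v_0,\dots,v_{q-1}\in\mathbb{R}^d$ fixed velocities with components $v_j^\alpha$, and $P_0,\dots,P_{q-1}\in\mathbb{R}[X_1,\dots,X_d]$ linearly independent polynomials with $P_0=1$ and $P_\alpha=X_\alpha$ for $1\le\alpha\le d$. Let $\widetilde u=\widetilde u(x,t)$ be a given regular $\mathbb{R}^d$-valued function, and $M(\widetilde u)$ the $q\times q$ matrix with entries $M_{kj}(\widetilde u)=P_k(v_j-\widetilde u)$, assumed invertible for every value of $\widetilde u$. Greek sums run from $1$ to $d$, Latin sums from $0$ to $q-1$ (with the indicated restrictions). The unknown is $f=(f_0,\dots,f_{q-1})(x,t)$; put $\rho=\sum_j f_j$, $q^\alpha=\sum_j v_j^\alpha f_j$, and $m(\widetilde u)=M(\widetilde u)f$. The equilibrium $f^{\rm eq}$ is a given regular function of the conserved quantities $(\rho,q^1,\dots,q^d)$, independent of $\widetilde u$, with $\sum_j f_j^{\rm eq}=\rho$, $\sum_j v_j^\alpha f_j^{\rm eq}=q^\alpha$; put $m^{\rm eq}(\widetilde u)=M(\widetilde u)f^{\rm eq}$. One time step of length $\Delta>0$ consists of the relaxation $$m_k^\star(\widetilde u)=m_k(\widetilde u)+s_k\big(m_k^{\rm eq}(\widetilde u)-m_k(\widetilde u)\big),\quad 0\le k\le q-1,\qquad f^\star=M(\widetilde u)^{-1}m^\star(\widetilde u),$$ at each $(x,t)$, followed by the transport $f_j(x,t+\Delta)=f_j^\star(x-v_j\Delta,t)$. The relaxation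 parameters $s_k$ are fixed, with $s_k=0$ for $k\le d$ and $s_k\ne0$ for $k>d$. **Formal expansion convention.** Expansions are for $\Delta\to0$ with the velocities $v_j$ and parameters $s_k$ fixed (acoustic scaling). The distributions are assumed to be restrictions of sufficiently regular functions of $(x,t)\in\mathbb{R}^d\times\mathbb{R}$ satisfying the scheme at all points, Taylor's formula can be used to any order, and $\mathcal{O}(\Delta^p)$ terms remain $\mathcal{O}(\Delta^p)$ after differentiation in $x$ or $t$. *)

(* Defs.v *)
(* MathComp and MathComp-Analysis. *)
From HB Require Import structures.
From mathcomp Require Import all_boot all_order all_algebra.
From mathcomp Require Import all_classical all_reals all_analysis.
(* The notations of mpoly clash with those of analysis: only its canonical
   instances are imported, and its constants are used with qualified names. *)
From mathcomp Require Import (canonicals) mpoly.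

Set Implicit Arguments.
Unset Strict Implicit.
Unset Printing Implicit Defensive.

Import Order.TTheory GRing.Theory Num.Theory.
Import numFieldNormedType.Exports.

Local Open Scope classical_set_scope.
Local Open Scope ring_scope.

(** * Smooth functions, and families of them depending on a time step *)

Section Smooth.
Context {R : realType} {V : normedModType R}.

(* [:: v1; ...; vn] is sent to 'D_v1 ('D_v2 (... ('D_vn g))). *)
Definition iter_derive (vs : seq V) (g : V -> R) : V -> R :=
  foldr (fun v h => 'D_v h) g vs.

(* For W open in a finite-dimensional V, this is C^infinity on W: all partial
   derivatives of all orders exist on W and are differentiable, hence
   continuous, there. *)
Definition smooth_on (W : set V) (g : V -> R) : Prop :=
  forall (vs : seq V) (z : V), W z -> differentiable (iter_derive vs g) z.

(* g D = O(D ^ p) as D -> 0+, in the sense of formal expansions, where an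
   O(D ^ p) stays an O(D ^ p) under differentiation: all derivatives of g D
   are O(D ^ p), uniformly on compact sets. Uniformity on compact sets is what
   makes the remainders of Taylor's formula, in which points are shifted by
   quantities of order D, of the expected order. For p = 0 this says that
   (g D) is a family of smooth functions, bounded with all its derivatives. *)
Definition smooth_bigO (p : nat) (g : R -> V -> R) : Prop :=
  (\forall D \near 0^'+, smooth_on setT (g D)) /\
  forall (vs : seq V) (K : set V), compact K ->
    exists C : R, \forall D \near 0^'+, forall z : V, K z ->
      `|iter_derive vs (g D) z| <= C * D ^+ p.

(* The family c of functions takes its values in W, and does not approach the
   boundary of W (nor infinity) as D -> 0+, locally uniformly. If W = setT and
   U is finite-dimensional, this holds as soon as c is bounded on compact sets,
   uniformly in D. *)
Definition stays_in {U : normedModType R} (W : set U) (c : R -> V -> U) : Prop :=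
  (\forall D \near 0^'+, forall z : V, W (c D z)) /\
  forall K : set V, compact K ->
    exists2 K' : set U, compact K' /\ K' `<=` W &
      \forall D \near 0^'+, forall z : V, K z -> K' (c D z).

End Smooth.

(** * Derivatives in space and time, on functions of (x, t) *)

Section SpaceTime.
Context {R : realType} {d : nat}.

Definition d_t (g : 'rV[R]_d * R -> R) : 'rV[R]_d * R -> R := 'D_(0, 1) g.

Definition d_x (b : 'I_d) (g : 'rV[R]_d * R -> R) : 'rV[R]_d * R -> R :=
  'D_(delta_mx 0 b, 0) g.

(* Derivative along the characteristics of velocity w. *)
Definition d_along (w : 'rV[R]_d) (g : 'rV[R]_d * R -> R) (z : 'rV[R]_d * R) : R :=
  d_t g z + \sum_(c < d) w 0 c * d_x c g z.

End SpaceTime.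

(** * Lattice Boltzmann scheme with relative velocities *)

Section Scheme.
Context {R : realType} {d q : nat}.

(* Moments are indexed by 'I_q = {0, ..., q-1}, space coordinates by
   'I_d = {0, ..., d-1}: the coordinate written alpha in {1, ..., d} is the
   element a of 'I_d with alpha = a.+1. *)
Definition moment_polynomials (P : 'I_q -> mpoly.mpoly d R) : Prop :=
  [/\ forall k : 'I_q, k = 0%N :> nat -> P k = (1 : mpoly.mpoly d R),
      forall (k : 'I_q) (a : 'I_d), k = a.+1 :> nat ->
        P k = mpoly.mpolyX R (mpoly.mnm1 a)
    & forall c : 'I_q -> R,
        \sum_(k < q) c k *: P k = 0 :> mpoly.mpoly d R -> forall k, c k = 0].

Definition moment_mx (P : 'I_q -> mpoly.mpoly d R) (v : 'I_q -> 'rV[R]_d)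
    (u : 'rV[R]_d) : 'M[R]_q :=
  \matrix_(k, j) mpoly.meval ((v j - u) 0) (P k).

Definition density (f : 'cV[R]_q) : R := \sum_(j < q) f j 0.

Definition momentum (v : 'I_q -> 'rV[R]_d) (f : 'cV[R]_q) : 'rV[R]_d :=
  \row_(a < d) \sum_(j < q) v j 0 a * f j 0.

Definition conserved (v : 'I_q -> 'rV[R]_d) (f : 'cV[R]_q) : R * 'rV[R]_d :=
  (density f, momentum v f).

Definition relaxed (s : 'I_q -> R) (M : 'M[R]_q) (f fe : 'cV[R]_q) : 'cV[R]_q :=
  let m := M *m f in
  let me := M *m fe in
  invmx M *m \col_k (m k 0 + s k * (me k 0 - m k 0)).

(* The distributions at equilibrium, f^eq(rho, q^1, ..., q^d). *)
Definition equilibrium (v : 'I_q -> 'rV[R]_d) (feq : R * 'rV[R]_d -> 'cV[R]_q)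
    (f : 'rV[R]_d * R -> 'cV[R]_q) (z : 'rV[R]_d * R) : 'cV[R]_q :=
  feq (conserved v (f z)).

Definition post_collision (P : 'I_q -> mpoly.mpoly d R) (v : 'I_q -> 'rV[R]_d)
    (s : 'I_q -> R) (ut : 'rV[R]_d * R -> 'rV[R]_d)
    (feq : R * 'rV[R]_d -> 'cV[R]_q) (f : 'rV[R]_d * R -> 'cV[R]_q)
    (z : 'rV[R]_d * R) : 'cV[R]_q :=
  relaxed s (moment_mx P v (ut z)) (f z) (equilibrium v feq f z).

Definition satisfies_scheme (P : 'I_q -> mpoly.mpoly d R) (v : 'I_q -> 'rV[R]_d)
    (s : 'I_q -> R) (ut : 'rV[R]_d * R -> 'rV[R]_d)
    (feq : R * 'rV[R]_d -> 'cV[R]_q) (D : R)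
    (f : 'rV[R]_d * R -> 'cV[R]_q) : Prop :=
  forall (x : 'rV[R]_d) (t : R) (j : 'I_q),
    f (x, t + D) j 0 = post_collision P v s ut feq f (x - D *: v j, t) j 0.

Definition momentum_flux (v : 'I_q -> 'rV[R]_d) (fe : 'cV[R]_q) (a b : 'I_d) : R :=
  \sum_(j < q) v j 0 a * v j 0 b * fe j 0.

Definition sigma (s : 'I_q -> R) (l : 'I_q) : R := (s l)^-1 - 2^-1.

(* fe is the function (x, t) |-> f^eq. *)
Definition theta (P : 'I_q -> mpoly.mpoly d R) (v : 'I_q -> 'rV[R]_d)
    (ut : 'rV[R]_d * R -> 'rV[R]_d) (fe : 'rV[R]_d * R -> 'cV[R]_q)
    (l : 'I_q) (z : 'rV[R]_d * R) : R :=
  \sum_(j < q) moment_mx P v (ut z) l j * d_along (v j) (fun y => fe y j 0) z.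

Definition Lambda (P : 'I_q -> mpoly.mpoly d R) (v : 'I_q -> 'rV[R]_d)
    (a b : 'I_d) (l : 'I_q) (u : 'rV[R]_d) : R :=
  \sum_(j < q) v j 0 a * v j 0 b * invmx (moment_mx P v u) j l.

End Scheme.

(* Main.v *)
Require Import Defs.
From HB Require Import structures.
From mathcomp Require Import all_boot all_order all_algebra.
From mathcomp Require Import all_classical all_reals all_analysis.
From mathcomp Require Import ring.
From mathcomp Require Import (canonicals) mpoly.

Import Order.TTheory GRing.Theory Num.Theory.
Import numFieldNormedType.Exports.

Local Open Scope classical_set_scope.
Local Open Scope ring_scope.

(** Let [g = M (f^eq - f)] be the gap of the moments to equilibrium, and let
  [phi_j = f_j(. + D w_j) - f_j], with [w_j = (v_j, 1)] and time step [D]. The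
  scheme reads [M phi = s g]. Since [s] and [g] vanish on the conserved moments,
  [phi = O(D)] gives [g = O(D)], hence [f = f^eq + O(D)]; then
  [phi = D d_t f + O(D^2)] refines this to [s g = D theta + O(D^2)]. Finally,
  [c . phi = 0] for [c = 1] and [c = v^a]; Taylor's formula at order 3 turns
  this into [c . (d_t f + D/2 d_t^2 f) = O(D^2)], where [d_t^2 f] splits into the
  time derivative of [c . d_t f = O(D)] and the divergence of a flux in which
  [f] is replaced by [f^eq - M^-1 g]: the two contributions of order [D] add up
  to the coefficient [1/s - 1/2]. *)

(** * Smooth functions *)

Section SmoothCalculus.
Context {R : realType} {V : normedModType R}.
Implicit Types (f g : V -> R) (v w z : V).

(** Dividing by the time step and taking divergences preserve orders because [smooth_bigO] controls
    all derivatives locally uniformly. The relative velocity is harmless for two reasons. The first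
    [d + 1] rows of [M] are an invertible triangular combination of mass and momentum, so vanishing
    of the conserved moments does not depend on [ut]; and the relation between moments is a
    pointwise identity, so no derivative of [ut] enters the expansion of the gap. The delicate point
    is the restriction to [l > d]: the gap vanishes exactly for [l <= d], but [theta_l] does not.
    There [s_l = 0] turns the expansion of the gap into [D theta_l = O(D^2)], and [theta_l = O(D)]
    suffices since it is multiplied by [D]. In the coefficient, [1/s] comes from solving the
    relaxation for the gap, and [- 1/2] from the [D/2] of Taylor's formula, in which [f] may be
    replaced by [f^eq]. *)

Lemma iter_derive_rcons (vs : seq V) v g :
  iter_derive (rcons vs v) g = iter_derive vs ('D_v g).
Proof. by rewrite /iter_derive foldr_rcons. Qed.

Lemma deriveD_fun f g v :
  (forall z, differentiable f z) -> (forall z, differentiable g z) ->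
  'D_v (fun z => f z + g z) = fun z => 'D_v f z + 'D_v g z.
Proof.
move=> df dg; apply/funext => z.
by apply: deriveD; apply: diff_derivable.
Qed.

Lemma deriveM_fun f g v :
  (forall z, differentiable f z) -> (forall z, differentiable g z) ->
  'D_v (fun z => f z * g z) = fun z => 'D_v f z * g z + f z * 'D_v g z.
Proof.
move=> df dg; apply/funext => z.
rewrite [LHS]deriveM; [|exact: diff_derivable|exact: diff_derivable].
by rewrite addrC -[_ *: 'D_v f z]/(g z * 'D_v f z) [g z * _]mulrC.
Qed.

Lemma deriveZ_fun (k : R) g v :
  (forall z, differentiable g z) ->
  'D_v (fun z => k * g z) = fun z => k * 'D_v g z.
Proof.
move=> dg; apply/funext => z; apply: deriveZ; exact: diff_derivable.
Qed.

Lemma deriveV_fun g v :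
  (forall z, differentiable g z) -> (forall z, g z != 0) ->
  'D_v (fun z => (g z)^-1) = fun z => - 'D_v g z * ((g z)^-1 * (g z)^-1).
Proof.
move=> dg g0; apply/funext => z.
rewrite [LHS]deriveV //; last exact: diff_derivable.
by rewrite -[_ *: _]/(_ * _) !mulNr mulrC -exprVn expr2.
Qed.

Lemma derive_translate g v w : 'D_v (fun z => g (z + w)) = fun z => 'D_v g (z + w).
Proof.
apply/funext => z; rewrite /derive /=.
by under eq_fun do rewrite -addrA.
Qed.

Lemma differentiable_translate g w z :
  differentiable g (z + w) -> differentiable (fun y => g (y + w)) z.
Proof.
move=> dg; apply: (@differentiable_comp _ _ _ _ (fun y => y + w) g) => //.
Qed.

Lemma iter_derive_translate (vs : seq V) g w :
  iter_derive vs (fun z => g (z + w)) = fun z => iter_derive vs g (z + w).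
Proof.
elim: vs => //= v vs ->; exact: derive_translate.
Qed.

(** Truncation to order [n] supplies the induction variable: the derivative of a product, inverse or
    composite has the same form, with one order less to check. *)
Definition smooth_upto (n : nat) g : Prop :=
  forall (vs : seq V) z, (size vs <= n)%N -> differentiable (iter_derive vs g) z.

Lemma smoothP g : smooth_on setT g <-> forall n, smooth_upto n g.
Proof.
split=> [sg n vs z _|sg vs z _]; first exact: sg.
exact: (sg (size vs)).
Qed.

Lemma smooth_upto0 g : (forall z, differentiable g z) -> smooth_upto 0 g.
Proof. by move=> dg [|v vs]. Qed.

Lemma smooth_uptoS n g :
  (forall z, differentiable g z) -> (forall v, smooth_upto n ('D_v g)) ->
  smooth_upto n.+1 g.
Proof.
move=> dg sg vs z; case/lastP: vs => [|vs v] //.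
by rewrite size_rcons iter_derive_rcons => ?; apply: sg.
Qed.

Lemma smooth_uptoW {n g} : smooth_upto n.+1 g -> smooth_upto n g.
Proof. by move=> sg vs z le_vs; apply: sg; rewrite (leq_trans le_vs). Qed.

Lemma smooth_upto_differentiable {n g} z : smooth_upto n g -> differentiable g z.
Proof. by move=> sg; apply: (sg [::]). Qed.

Lemma smooth_upto_derive {n g} v : smooth_upto n.+1 g -> smooth_upto n ('D_v g).
Proof.
by move=> sg vs z le_vs; rewrite -iter_derive_rcons; apply: sg; rewrite size_rcons.
Qed.

Lemma smooth_differentiable {W : set V} {g} z :
  smooth_on W g -> W z -> differentiable g z.
Proof. by move=> sg Wz; apply: (sg [::] z). Qed.

Lemma smooth_derive {W : set V} {g} v : smooth_on W g -> smooth_on W ('D_v g).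
Proof. by move=> sg vs z Wz; rewrite -iter_derive_rcons; apply: sg. Qed.

Lemma smooth_continuous {W : set V} {g} z : smooth_on W g -> W z -> {for z, continuous g}.
Proof. by move=> sg Wz; apply/differentiable_continuous/(smooth_differentiable _ sg). Qed.

Lemma smooth_upto_cst n (k : R) : smooth_upto n (fun=> k).
Proof.
elim: n k => [|n IHn] k; first by apply: smooth_upto0 => z; apply: differentiable_cst.
apply: smooth_uptoS => [z|v]; first exact: differentiable_cst.
by rewrite (_ : 'D_v _ = fun=> 0) //; apply/funext => z; rewrite derive_cst.
Qed.

Lemma smooth_uptoD n f g :
  smooth_upto n f -> smooth_upto n g -> smooth_upto n (fun z => f z + g z).
Proof.
elim: n f g => [|n IHn] f g sf sg.
  by apply: smooth_upto0 => z; apply: differentiableD; apply: smooth_upto_differentiable; eauto.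
have df z := smooth_upto_differentiable z sf.
have dg z := smooth_upto_differentiable z sg.
apply: smooth_uptoS => [z|v]; first exact: differentiableD.
by rewrite deriveD_fun //; apply: IHn; apply: smooth_upto_derive.
Qed.

Lemma smooth_uptoM n f g :
  smooth_upto n f -> smooth_upto n g -> smooth_upto n (fun z => f z * g z).
Proof.
elim: n f g => [|n IHn] f g sf sg.
  by apply: smooth_upto0 => z; apply: differentiableM; apply: smooth_upto_differentiable; eauto.
have df z := smooth_upto_differentiable z sf.
have dg z := smooth_upto_differentiable z sg.
apply: smooth_uptoS => [z|v]; first exact: differentiableM.
rewrite deriveM_fun //; apply: smooth_uptoD; apply: IHn.
- exact: smooth_upto_derive.
- exact: smooth_uptoW.
- exact: smooth_uptoW.
- exact: smooth_upto_derive.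
Qed.

Lemma smooth_upto_sum n (I : Type) (r : seq I) (P : pred I) (F : I -> V -> R) :
  (forall i, P i -> smooth_upto n (F i)) ->
  smooth_upto n (fun z => \sum_(i <- r | P i) F i z).
Proof.
move=> sF; elim: r => [|i r IHr].
  rewrite (_ : (fun z => _) = fun=> 0); first exact: smooth_upto_cst.
  by apply/funext => z; rewrite big_nil.
rewrite (_ : (fun z => _) = fun z => if P i then F i z + \sum_(j <- r | P j) F j z
                                     else \sum_(j <- r | P j) F j z); last first.
  by apply/funext => z; rewrite big_cons.
case Pi: (P i) => //; apply: smooth_uptoD => //; exact: sF.
Qed.

(** The derivative of [1/g] is a product of ['D_v g] with two copies of [1/g], to which the
    induction hypothesis applies. *)
Lemma smoothV g : smooth_on setT g -> (forall z, g z != 0) ->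
  smooth_on setT (fun z => (g z)^-1).
Proof.
move=> sg g0; apply/smoothP; elim=> [|n IHn].
  by apply: smooth_upto0 => z; apply: differentiableV => //; apply: (smooth_differentiable _ sg).
have dg z : differentiable g z by apply: (smooth_differentiable _ sg).
apply: smooth_uptoS => [z|v]; first exact: differentiableV.
rewrite deriveV_fun //; apply: smooth_uptoM; last exact: smooth_uptoM.
rewrite (_ : (fun z => - _) = fun z => -1 * 'D_v g z); last first.
  by apply/funext => z; rewrite mulN1r.
apply: smooth_uptoM; first exact: smooth_upto_cst.
by move: n {IHn}; apply/smoothP; apply: smooth_derive.
Qed.

End SmoothCalculus.

Section Composition.
Context {R : realType} {V U : normedModType R} {m : nat}.
Implicit Types (v z : V).

(** Writing the inner map with scalar coefficients on fixed vectors keeps the chain rule within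
    scalar functions: each term is a composite of the same form, with ['D_(e i) F] for [F], times a
    derivative of a coefficient. This makes the later inductions close up. *)
Lemma derive_comp_sum (W : set U) (F : U -> R)
    (e : 'I_m -> U) (c : 'I_m -> V -> R) v z :
  smooth_on W F -> (forall i z, differentiable (c i) z) ->
  W (\sum_i c i z *: e i) ->
  differentiable (fun y => F (\sum_i c i y *: e i)) z /\
  'D_v (fun y => F (\sum_i c i y *: e i)) z =
    \sum_i 'D_(e i) F (\sum_i c i z *: e i) * 'D_v (c i) z.
Proof.
move=> sF dc Wz.
have dcz i : differentiable (fun y => c i y *: e i) z by apply: differentiableZl.
have sumE : (fun y => \sum_i c i y *: e i) = \sum_i (fun y => c i y *: e i).
  by apply/funext => y; rewrite fct_sumE.
have dsum : differentiable (fun y => \sum_i c i y *: e i) z.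
  by rewrite sumE; apply: differentiable_sum.
have dF := smooth_differentiable _ sF Wz.
have dcomp : differentiable (F \o (fun y => \sum_i c i y *: e i)) z.
  exact: differentiable_comp.
split => //.
rewrite (_ : (fun y => F _) = F \o (fun y => \sum_i c i y *: e i)) //.
rewrite deriveE // diff_comp //=.
have -> : 'd (fun y => \sum_i c i y *: e i) z v = \sum_i 'D_v (c i) z *: e i.
  rewrite -deriveE // sumE derive_sum; last by move=> i; exact: diff_derivable.
  by apply: eq_bigr => i _; rewrite !deriveE // diffZl.
rewrite linear_sum; apply: eq_bigr => i _.
by rewrite linearZ /= -deriveE // mulrC.
Qed.

Lemma smooth_comp (W : set U) (F : U -> R)
    (e : 'I_m -> U) (c : 'I_m -> V -> R) :
  smooth_on W F -> (forall i, smooth_on setT (c i)) ->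
  (forall z, W (\sum_i c i z *: e i)) ->
  smooth_on setT (fun z => F (\sum_i c i z *: e i)).
Proof.
move=> sF sc Wc; apply/smoothP => n.
have dc i z : differentiable (c i) z by apply: (smooth_differentiable _ (sc i)).
elim: n F sF => [|n IHn] F sF.
  by apply: smooth_upto0 => z; have [] := derive_comp_sum _ _ e c 0 z sF dc (Wc z).
apply: smooth_uptoS => [z|v].
  by have [] := derive_comp_sum _ _ e c 0 z sF dc (Wc z).
rewrite (_ : 'D_v _ = fun z => \sum_i 'D_(e i) F (\sum_i c i z *: e i) * 'D_v (c i) z).
  apply: smooth_upto_sum => i _; apply: smooth_uptoM.
    exact: IHn (smooth_derive _ sF).
  by move: n {IHn}; apply/smoothP; apply: smooth_derive.
by apply/funext => z; have [_] := derive_comp_sum _ _ e c v z sF dc (Wc z).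
Qed.

End Composition.

(** * Symmetry of second derivatives and Taylor's formula *)

Lemma rcons_nseq (T : Type) n (x : T) : rcons (nseq n x) x = nseq n.+1 x.
Proof. by elim: n => //= n ->. Qed.

Section Taylor.
Context {R : realType} {V : normedModType R}.
Implicit Types (f g : V -> R) (v w z : V).

(** The one-variable difference quotient along the line is literally the quotient defining the
    directional derivative. *)
Lemma is_derive_line g w z (s : R) : differentiable g (z + s *: w) ->
  is_derive s (1 : R) (fun s : R => g (z + s *: w)) ('D_w g (z + s *: w)).
Proof.
move=> dg.
have E : (fun h : R => h^-1 *: ((fun s : R => g (z + s *: w)) (h *: (1 : R) + s) - g (z + s *: w)))
       = (fun h : R => h^-1 *: (g (h *: w + (z + s *: w)) - g (z + s *: w))).
  apply/funext => h; congr (_ *: (g _ - _)).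
  by rewrite -[h *: 1]/(h * 1) mulr1 scalerDl addrCA.
apply: DeriveDef.
  by rewrite /derivable E; apply: diff_derivable.
by rewrite /derive E.
Qed.

Lemma mvt_line g w z (s : R) : (forall y, differentiable g y) -> 0 <= s ->
  exists2 c : R, 0 <= c <= s & g (z + s *: w) - g z = s * 'D_w g (z + c *: w).
Proof.
move=> dg s0.
have [||c] := @MVT_segment R (fun s => g (z + s *: w)) (fun c => 'D_w g (z + c *: w)) 0 s s0.
- by move=> x _; apply: is_derive_line.
- apply: derivable_within_continuous => x _.
  by case: (is_derive_line g w z x (dg _)).
- rewrite in_itv /= scale0r addr0 subr0 => cs ->.
  by exists c => //; rewrite mulrC.
Qed.

Lemma derive_comm g v w : smooth_on setT g -> 'D_v ('D_w g) = 'D_w ('D_v g).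
Proof.
(* A mixed second difference of g divided by h ^+ 2 is, by the mean value
   theorem, a value of either mixed derivative at a point close to z. *)
have half (h : R) v1 w1 (z : V) : smooth_on setT g -> 0 < h ->
    exists a b : R, [/\ 0 <= a <= h, 0 <= b <= h &
      'D_w1 ('D_v1 g) (z + (a *: v1 + b *: w1)) =
      (g (z + h *: v1 + h *: w1) - g (z + h *: v1) - (g (z + h *: w1) - g z)) / h / h].
  move=> sg /[dup] /lt0r_neq0 hN0 /ltW h0.
  have dg y : differentiable g y by apply: (smooth_differentiable _ sg).
  have dg1 y : differentiable (fun z => g (z + h *: w1)) y by apply: differentiable_translate.
  have dNg y : differentiable (fun z => -1 * g z) y by apply: differentiableZ.
  (* The mean value theorem is applied to this first difference in direction [v1], then to ['D_v1 g]
     in direction [w1]. *)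
  pose k y := g (y + h *: w1) + -1 * g y.
  have dk y : differentiable k y by apply: differentiableD.
  have [a ha ka] := mvt_line _ v1 z h dk h0.
  have [b hb kb] := mvt_line _ w1 (z + a *: v1) h
    (fun y => smooth_differentiable y (smooth_derive v1 sg) Logic.I) h0.
  exists a, b; split => //; rewrite addrA.
  apply: (canRL (mulfK hN0)); apply: (canRL (mulfK hN0)); rewrite mulrC [_ * h]mulrC -kb.
  have Dk y : 'D_v1 k y = 'D_v1 g (y + h *: w1) - 'D_v1 g y.
    rewrite -['D_v1 g y in RHS]mul1r -mulNr.
    rewrite -[LHS]/(('D_v1 k : V -> R) y) (deriveD_fun _ _ v1 dg1 dNg).
    rewrite -(congr1 (@^~ y) (derive_translate g v1 (h *: w1))).
    by rewrite -(congr1 (@^~ y) (deriveZ_fun (-1) g v1 dg)).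
  by move: ka; rewrite Dk => <-; rewrite /k !mulN1r.
move=> sg; apply/funext => z.
have cA : {for z, continuous ('D_v ('D_w g))}.
  exact: smooth_continuous z (smooth_derive _ (smooth_derive _ sg)) Logic.I.
have cB : {for z, continuous ('D_w ('D_v g))}.
  exact: smooth_continuous z (smooth_derive _ (smooth_derive _ sg)) Logic.I.
apply/eqP; rewrite -subr_eq0 -normr_le0; apply/ler_addgt0Pl => e e0; rewrite addr0.
have e20 : 0 < e / 2 by rewrite divr_gt0.
move: cA => /cvgrPdist_lt/(_ _ e20)/nbhs_normP[dA /= dA0 hA].
move: cB => /cvgrPdist_lt/(_ _ e20)/nbhs_normP[dB /= dB0 hB].
(* The summand 1 keeps [N] positive even for zero directions, and makes the displacement strictly
   smaller than [h * N], the smaller of the two radii. *)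
pose N := `|v| + `|w| + 1.
have N0 : 0 < N by rewrite ltr_wpDl // addr_ge0.
pose h := Num.min dA dB / N.
have h0 : 0 < h by rewrite divr_gt0 // lt_min dA0.
have near_z v1 w1 a b : `|v1| + `|w1| + 1 = N -> 0 <= a <= h -> 0 <= b <= h ->
    `|z - (z + (a *: v1 + b *: w1))| < Num.min dA dB.
  move=> NE /andP[a0 ah] /andP[b0 bh].
  rewrite opprD addNKr normrN (le_lt_trans (ler_normD _ _)) //.
  rewrite !normrZ (ger0_norm a0) (ger0_norm b0).
  rewrite -[ltRHS](@divfK _ N) ?gt_eqF // -/h -NE 2!mulrDr mulr1 ltr_pwDr //.
  by rewrite lerD // ler_wpM2r.
have [a [b [ha hb E1]]] := half h w v z sg h0.
have [a' [b' [ha' hb' E2]]] := half h v w z sg h0.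
(* The second difference is symmetric in the two directions, so both mixed derivatives take this
   common value near [z]. *)
have {}E1 : 'D_v ('D_w g) (z + (a *: w + b *: v)) = 'D_w ('D_v g) (z + (a' *: v + b' *: w)).
  rewrite E1 E2; congr (_ / h / h).
  by rewrite !opprB addrACA [RHS]addrACA (addrAC z); congr (_ + _); rewrite addrC.
have nA := near_z w v a b; have nB := near_z v w a' b'.
have {}nA := nA (congr1 (+%R^~ 1) (addrC _ _)) ha hb.
have {}nB := nB erefl ha' hb'.
apply: (le_trans (ler_distD ('D_v ('D_w g) (z + (a *: w + b *: v))) _ _)).
rewrite (splitr e); apply: lerD.
  by apply/ltW/hA => /=; apply: lt_le_trans nA _; rewrite ge_min lexx.
rewrite E1 distrC; apply/ltW/hB => /=; apply: lt_le_trans nB _.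
by rewrite ge_min lexx orbT.
Qed.

Lemma iter_derive_smooth (W : set V) (vs : seq V) g :
  smooth_on W g -> smooth_on W (iter_derive vs g).
Proof.
by elim: vs g => [|v vs IHvs] g sg //=; apply/smooth_derive/IHvs.
Qed.

(** This lets a derivative of a Taylor remainder be read as the remainder of the derivative. *)
Lemma iter_derive_comm (vs ws : seq V) g : smooth_on setT g ->
  iter_derive vs (iter_derive ws g) = iter_derive ws (iter_derive vs g).
Proof.
move=> sg; elim: vs => [//|v vs IHvs].
rewrite -[LHS]/('D_v (iter_derive vs (iter_derive ws g))) IHvs.
rewrite -[iter_derive (v :: vs) g]/('D_v (iter_derive vs g)).
elim: ws {IHvs} => [//|w ws IHws].
rewrite -[RHS]/('D_w (iter_derive ws ('D_v (iter_derive vs g)))) -IHws.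
apply: derive_comm; exact: iter_derive_smooth (iter_derive_smooth _ _ _ sg).
Qed.

Lemma iter_deriveD (vs : seq V) f g : smooth_on setT f -> smooth_on setT g ->
  iter_derive vs (fun z => f z + g z) = fun z => iter_derive vs f z + iter_derive vs g z.
Proof.
move=> sf sg; elim: vs => //= v vs ->.
by rewrite deriveD_fun // => z;
  [apply: (smooth_differentiable _ (iter_derive_smooth _ _ _ sf))|
   apply: (smooth_differentiable _ (iter_derive_smooth _ _ _ sg))].
Qed.

Lemma iter_deriveZ (vs : seq V) (k : R) g : smooth_on setT g ->
  iter_derive vs (fun z => k * g z) = fun z => k * iter_derive vs g z.
Proof.
move=> sg; elim: vs => //= v vs ->.
by rewrite deriveZ_fun // => z;
   apply: (smooth_differentiable _ (iter_derive_smooth _ _ _ sg)).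
Qed.

Lemma smooth_cst (k : R) : smooth_on setT (fun _ : V => k).
Proof. by apply/smoothP => n; apply: smooth_upto_cst. Qed.

Lemma smoothD f g : smooth_on setT f -> smooth_on setT g ->
  smooth_on setT (fun z => f z + g z).
Proof.
by move=> /smoothP sf /smoothP sg; apply/smoothP => n; apply: smooth_uptoD.
Qed.

Lemma smoothM f g : smooth_on setT f -> smooth_on setT g ->
  smooth_on setT (fun z => f z * g z).
Proof.
by move=> /smoothP sf /smoothP sg; apply/smoothP => n; apply: smooth_uptoM.
Qed.

Lemma smoothZ (k : R) g : smooth_on setT g -> smooth_on setT (fun z => k * g z).
Proof. by move=> sg; apply: smoothM => //; apply: smooth_cst. Qed.

Lemma smooth_sum (I : Type) (r : seq I) (P : pred I) (F : I -> V -> R) :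
  (forall i, P i -> smooth_on setT (F i)) ->
  smooth_on setT (fun z => \sum_(i <- r | P i) F i z).
Proof.
move=> sF; apply/smoothP => n; apply: smooth_upto_sum => i Pi.
by move: n; apply/smoothP; apply: sF.
Qed.

Lemma smooth_translate g w : smooth_on setT g -> smooth_on setT (fun z => g (z + w)).
Proof.
move=> sg vs z _; rewrite iter_derive_translate.
by apply: differentiable_translate; apply: sg.
Qed.

End Taylor.

Section TaylorB.
Context {R : realType} {V : normedModType R}.
Implicit Types (f g : V -> R) (v w z : V).

Lemma is_derive_monomial (i : nat) (t K : R) :
  is_derive t (1 : R) (fun t : R => i.+1`!%:R^-1 * t ^+ i.+1 * K) (i`!%:R^-1 * t ^+ i * K).
Proof.
have -> : (fun t : R => i.+1`!%:R^-1 * t ^+ i.+1 * K)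
        = (i.+1`!%:R^-1 * K) *: ((@idfun R : R -> R) ^+ i.+1).
  by apply/funext => y; rewrite mulrAC exprfctE.
apply: is_derive_eq.
have scE (a b : R) : a *: b = a * b by [].
rewrite /= !scE mulr1 factS natrM invfM.
have : i.+1%:R != 0 :> R by rewrite pnatr_eq0.
have : i`!%:R != 0 :> R by rewrite pnatr_eq0 -lt0n fact_gt0.
by move=> ? ?; field; apply/andP.
Qed.

(** The remainder [r] vanishes at 0 and its derivative [r'] is the remainder of one order less for
    ['D_w g], so the mean value theorem gives [r s = s * r' c]. Bounding [c ^+ n] by [s ^+ n] gives
    up the factor 1/n!, but a single constant [B] passes through the induction. *)
Lemma taylor_bound (n : nat) g w z (s B : R) : smooth_on setT g -> 0 <= s ->
  (forall c, 0 <= c <= s -> `|iter_derive (nseq n w) g (z + c *: w)| <= B) ->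
  `|g (z + s *: w) - \sum_(i < n) i`!%:R^-1 * s ^+ i * iter_derive (nseq i w) g z|
    <= B * s ^+ n.
Proof.
elim: n g s => [|n IHn] g s sg s0 leB.
  by rewrite big_ord0 subr0 expr0 mulr1; apply: leB; rewrite s0 lexx.
pose r (t : R) := g (z + t *: w) - \sum_(i < n.+1) i`!%:R^-1 * t ^+ i * iter_derive (nseq i w) g z.
pose r' (t : R) := 'D_w g (z + t *: w)
  - \sum_(i < n) i`!%:R^-1 * t ^+ i * iter_derive (nseq i w) ('D_w g) z.
have dr (t : R) : is_derive t (1 : R) r (r' t).
  have -> : r = (fun t => g (z + t *: w)) - (cst (g z) + \sum_(i < n)
      (fun t => i.+1`!%:R^-1 * t ^+ i.+1 * iter_derive (nseq i w) ('D_w g) z)).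
    apply/funext => y; rewrite /r big_ord_recl /= fact0 invr1 expr0 !mul1r.
    rewrite -[RHS]/(_ - (_ + (\sum_(i < n) _) y)) fct_sumE.
    congr (_ - (_ + _)); apply: eq_bigr => i _.
    by rewrite -iter_derive_rcons rcons_nseq.
  rewrite /r'.
  have d1 := is_derive_line g w z t (smooth_differentiable _ sg Logic.I).
  have d2 := is_derive_sum (fun i : 'I_n => is_derive_monomial i t
                                             (iter_derive (nseq i w) ('D_w g) z)).
  have d3 := is_derive_cst (g z) t (1 : R).
  have d4 := is_deriveD d3 d2.
  by have := is_deriveB d1 d4; rewrite add0r.
have r0 : r 0 = 0.
  Timeout 15 rewrite /r big_ord_recl /= scale0r addr0 expr0 mulr1 fact0 invr1 mul1r.
  Timeout 15 rewrite big1 ?addr0 ?subrr // => i _.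
  by rewrite expr0n /= mulr0 mul0r.
have [|c] := @MVT_segment R r r' 0 s s0.
  by apply: derivable_within_continuous => x _; case: (dr x).
rewrite in_itv /= => /andP[c0 cs]; rewrite r0 !subr0 => rs.
rewrite -[X in `|X|]/(r s) rs.
have B0 : 0 <= B by apply: le_trans (leB 0 _) => //; rewrite lexx.
have : `|r' c| <= B * c ^+ n.
  apply: IHn => //; first exact: smooth_derive.
  move=> c' /andP[c'0 c'c]; rewrite -iter_derive_rcons rcons_nseq; apply: leB.
  by rewrite c'0 (le_trans c'c).
move=> le_r'; rewrite normrM (ger0_norm s0) exprSr mulrA ler_wpM2r //.
apply: le_trans le_r' _; rewrite ler_wpM2l //.
by rewrite lerXn2r // nnegrE.
Qed.

End TaylorB.

(** * Calculus of smooth O(D ^ p) *)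

Lemma compact_norm_bound {R : realType} {U : normedModType R} (K : set U)
    (F : U -> R) : compact K ->
  (forall z, K z -> {for z, continuous F}) -> exists C, forall z, K z -> `|F z| <= C.
Proof.
move=> cK cF.
have /compact_bounded[M [_ MF]] : compact (F @` K).
  by apply: continuous_compact => //; apply: continuous_in_subspaceT => z /set_mem /cF.
(* Boundedness provides the bound for every real strictly above [M]. *)
by exists (M + 1) => z Kz; apply: (MF (M + 1)); [rewrite ltrDl | exists z].
Qed.

Lemma iter_derive_sum {R : realType} {V : normedModType R} (vs : seq V) (I : Type)
    (r : seq I) (P : pred I) (F : I -> V -> R) : (forall i, P i -> smooth_on setT (F i)) ->
  iter_derive vs (fun z => \sum_(i <- r | P i) F i z) =
  fun z => \sum_(i <- r | P i) iter_derive vs (F i) z.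
Proof.
move=> sF; elim: r => [|i r IHr].
  have -> : (fun z : V => \sum_(i <- [::] | P i) F i z) = fun=> 0.
    by apply/funext => z; rewrite big_nil.
  elim: vs => [|v vs IHvs].
    by apply/funext => z; rewrite big_nil.
  rewrite -[LHS]/('D_v (iter_derive vs (fun=> 0))) IHvs.
  apply/funext => z; rewrite big_nil.
  rewrite (_ : (fun z => _) = cst (0 : R)) ?derive_cst //.
  by apply/funext => y; rewrite big_nil.
case Pi: (P i); last first.
  rewrite (_ : (fun z => \sum_(i <- i :: r | P i) F i z) = fun z => \sum_(i <- r | P i) F i z).
    by rewrite IHr; apply/funext => z; rewrite big_cons Pi.
  by apply/funext => z; rewrite big_cons Pi.
rewrite (_ : (fun z => \sum_(i <- i :: r | P i) F i z) =
  fun z => F i z + \sum_(i <- r | P i) F i z); last first.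
  by apply/funext => z; rewrite big_cons Pi.
rewrite iter_deriveD; [|exact: sF|exact: smooth_sum].
by rewrite IHr; apply/funext => z; rewrite big_cons Pi.
Qed.

Section BigO.
Context {R : realType} {V : normedModType R}.
Implicit Types (p n : nat) (g h : R -> V -> R) (G : V -> R) (v w z : V) (vs : seq V).

Lemma near_right_gt0 : \forall D \near (0 : R)^'+, 0 < D.
Proof. exact: nbhs_right_gt. Qed.

Lemma near_right_le1 : \forall D \near (0 : R)^'+, D <= 1.
Proof. by apply: nbhs_right_le; exact: ltr01. Qed.

(** Equality for small [D] is all that is available: the scheme itself is only assumed there. Most
    expansions below produce a remainder and then identify it through this lemma. *)
Lemma smooth_bigO_eq p {g} h : (\forall D \near 0^'+, g D = h D) ->
  smooth_bigO p g -> smooth_bigO p h.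
Proof.
move=> gh [sg Og]; split; first by apply: filterS2 gh sg => D ->.
move=> vs K cK; have [C gC] := Og vs K cK; exists C.
by apply: filterS2 gh gC => D ->.
Qed.

Lemma smooth_bigO_derive p g v : smooth_bigO p g ->
  smooth_bigO p (fun D => 'D_v (g D)).
Proof.
case=> sg Og; split; first by apply: filterS sg => D; apply: smooth_derive.
move=> vs K cK; have [C gC] := Og (rcons vs v) K cK; exists C.
by apply: filterS gC => D; rewrite iter_derive_rcons.
Qed.

Lemma smooth_bigO0 p : smooth_bigO p (fun (_ : R) (_ : V) => 0).
Proof.
split=> [|vs K cK]; first by apply: nearW => D; apply: smooth_cst.
exists 0; apply: nearW => D z _; rewrite mul0r.
suff -> : iter_derive vs (fun=> 0 : R) = fun=> 0 by rewrite normr0.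
elim: vs => // v vs IHvs; rewrite -[LHS]/('D_v (iter_derive vs (fun=> 0))) IHvs.
by apply/funext => y; rewrite derive_cst.
Qed.

Lemma smooth_bigO_scale p (k : R) g : smooth_bigO p g ->
  smooth_bigO p (fun D z => k * g D z).
Proof.
move=> [sg Og]; split; first by apply: filterS sg => D; apply: smoothZ.
move=> vs K cK; have [C gC] := Og vs K cK; exists (`|k| * C).
apply: filterS2 sg gC => D sgD gCD z Kz; rewrite iter_deriveZ //.
by rewrite normrM -mulrA ler_wpM2l // gCD.
Qed.

Lemma smooth_bigO_mulX p n g : smooth_bigO p g ->
  smooth_bigO (n + p) (fun D z => D ^+ n * g D z).
Proof.
move=> [sg Og]; split; first by apply: filterS sg => D; apply: smoothZ.
move=> vs K cK; have [C gC] := Og vs K cK; exists C.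
apply: filterS3 sg gC near_right_gt0 => D sgD gCD D0 z Kz; rewrite iter_deriveZ //.
rewrite normrM normrX gtr0_norm // exprD mulrCA ler_wpM2l ?gCD //.
by rewrite exprn_ge0 // ltW.
Qed.

(** [D] is a constant for differentiation in [z], so the bound on each derivative can be divided by
    [D ^+ n], which is positive near [0^'+]. *)
Lemma smooth_bigO_divX p n g : smooth_bigO (n + p) (fun D z => D ^+ n * g D z) ->
  smooth_bigO p g.
Proof.
move=> [sg Og].
have gE (D : R) : 0 < D -> g D = fun z => D ^- n * (D ^+ n * g D z).
  by move=> D0; apply/funext => z; rewrite mulKf // expf_neq0 // gt_eqF.
split; first by apply: filterS2 sg near_right_gt0 => D sgD /gE ->; apply: smoothZ.
move=> vs K cK; have [C gC] := Og vs K cK; exists C.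
apply: filterS3 sg gC near_right_gt0 => D sgD gCD D0 z Kz; rewrite (gE D D0) iter_deriveZ //.
have Dn : 0 < D ^+ n by rewrite exprn_gt0.
rewrite normrM normfV (gtr0_norm Dn) ler_pdivrMl // mulrCA -exprD; exact: gCD.
Qed.

(** Only the bounds are truncated, to allow induction on the order; smoothness stays complete, so
    the differentiation rules remain applicable. *)
Definition bigO_upto n p g : Prop :=
  (\forall D \near 0^'+, smooth_on setT (g D)) /\
  forall vs (K : set V), (size vs <= n)%N -> compact K ->
    exists C : R, \forall D \near 0^'+, forall z : V, K z ->
      `|iter_derive vs (g D) z| <= C * D ^+ p.

Lemma smooth_bigOP p g : smooth_bigO p g <-> forall n, bigO_upto n p g.
Proof.
split=> [[sg Og] n|Og]; first by split=> // vs K _; apply: Og.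
split=> [|vs K]; first by case: (Og 0).
by case: (Og (size vs)) => _; apply.
Qed.

Lemma bigO_upto_eq {n p g} h : (\forall D \near 0^'+, g D = h D) ->
  bigO_upto n p g -> bigO_upto n p h.
Proof.
move=> gh [sg Og]; split; first by apply: filterS2 gh sg => D ->.
move=> vs K le_vs cK; have [C gC] := Og vs K le_vs cK; exists C.
by apply: filterS2 gh gC => D ->.
Qed.

Lemma bigO_uptoS n p g : bigO_upto 0 p g ->
  (forall v, bigO_upto n p (fun D => 'D_v (g D))) -> bigO_upto n.+1 p g.
Proof.
move=> [sg Og] Odg; split=> // vs K; case/lastP: vs => [|vs v]; first by move=> _; apply: Og.
rewrite size_rcons => le_vs cK; have [C gC] := (Odg v).2 vs K le_vs cK.
by exists C; apply: filterS gC => D; rewrite iter_derive_rcons.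
Qed.

Lemma bigO_uptoW n p g : bigO_upto n.+1 p g -> bigO_upto n p g.
Proof. by case=> sg Og; split=> // vs K le_vs; apply: Og; rewrite (leq_trans le_vs). Qed.

Lemma bigO_upto_derive n p g v : bigO_upto n.+1 p g ->
  bigO_upto n p (fun D => 'D_v (g D)).
Proof.
case=> sg Og; split; first by apply: filterS sg => D; apply: smooth_derive.
move=> vs K le_vs cK; have [|C gC] := Og (rcons vs v) K _ cK; first by rewrite size_rcons.
by exists C; apply: filterS gC => D; rewrite iter_derive_rcons.
Qed.

Lemma bigO_uptoD n p g h : bigO_upto n p g -> bigO_upto n p h ->
  bigO_upto n p (fun D z => g D z + h D z).
Proof.
move=> [sg Og] [sh Oh]; split; first by apply: filterS2 sg sh => D; apply: smoothD.
move=> vs K le_vs cK; have [C gC] := Og vs K le_vs cK; have [C' hC] := Oh vs K le_vs cK.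
exists (C + C'); apply: (filterS2 _ _ (filterI sg sh) (filterI gC hC)).
move=> D [sgD shD] [gCD hCD] z Kz; rewrite iter_deriveD //.
by rewrite mulrDl (le_trans (ler_normD _ _)) // lerD // ?gCD ?hCD.
Qed.

Lemma bigO_uptoM n p1 p2 g h : bigO_upto n p1 g -> bigO_upto n p2 h ->
  bigO_upto n (p1 + p2) (fun D z => g D z * h D z).
Proof.
(* The undifferentiated bound serves both as base case and as first premise of [bigO_uptoS]. *)
have O0 g' h' k : bigO_upto k p1 g' -> bigO_upto k p2 h' ->
    bigO_upto 0 (p1 + p2) (fun D z => g' D z * h' D z).
  move=> Og Oh; split; first by apply: filterS2 Og.1 Oh.1 => D; apply: smoothM.
  move=> [|//] K _ cK; have [C gC] := Og.2 [::] K isT cK.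
  have [C' hC] := Oh.2 [::] K isT cK; exists (C * C').
  apply: filterS2 gC hC => D gCD hCD z Kz.
  rewrite /= normrM exprD mulrACA.
  by apply: ler_pM => //; [exact: gCD | exact: hCD].
elim: n g h => [|n IHn] g h Og Oh; first exact: O0 Og Oh.
apply: bigO_uptoS => [|v]; first exact: O0 Og Oh.
apply: (@bigO_upto_eq _ _ (fun D z => 'D_v (g D) z * h D z + g D z * 'D_v (h D) z)).
  apply: filterS2 Og.1 Oh.1 => D sg sh; rewrite deriveM_fun // => z.
    exact: smooth_differentiable _ sg _.
  exact: smooth_differentiable _ sh _.
by apply: bigO_uptoD; apply: IHn;
  [exact: bigO_upto_derive|exact: bigO_uptoW|exact: bigO_uptoW|exact: bigO_upto_derive].
Qed.

Lemma bigO_upto_sum n p (I : Type) (r : seq I) (P : pred I) (F : I -> R -> V -> R) :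
  (forall i, P i -> bigO_upto n p (F i)) ->
  bigO_upto n p (fun D z => \sum_(i <- r | P i) F i D z).
Proof.
move=> OF; elim: r => [|i r IHr].
  apply: bigO_upto_eq ((smooth_bigOP _ _).1 (smooth_bigO0 p) n); apply: nearW => D.
  by apply/funext => z; rewrite big_nil.
case Pi: (P i).
  apply: bigO_upto_eq (bigO_uptoD _ _ _ _ (OF i Pi) IHr); apply: nearW => D.
  by apply/funext => z; rewrite big_cons Pi.
apply: bigO_upto_eq IHr; apply: nearW => D.
by apply/funext => z; rewrite big_cons Pi.
Qed.

Lemma smooth_bigOD p g h : smooth_bigO p g -> smooth_bigO p h ->
  smooth_bigO p (fun D z => g D z + h D z).
Proof.
by move=> /smooth_bigOP Og /smooth_bigOP Oh; apply/smooth_bigOP => n; apply: bigO_uptoD.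
Qed.

Lemma smooth_bigON p g : smooth_bigO p g -> smooth_bigO p (fun D z => - g D z).
Proof.
move=> Og; apply: smooth_bigO_eq (smooth_bigO_scale _ (-1) _ Og); apply: nearW => D.
by apply/funext => z; rewrite mulN1r.
Qed.

Lemma smooth_bigOB p g h : smooth_bigO p g -> smooth_bigO p h ->
  smooth_bigO p (fun D z => g D z - h D z).
Proof. by move=> Og Oh; apply: smooth_bigOD => //; apply: smooth_bigON. Qed.

Lemma smooth_bigO_sum p (I : Type) (r : seq I) (P : pred I) (F : I -> R -> V -> R) :
  (forall i, P i -> smooth_bigO p (F i)) ->
  smooth_bigO p (fun D z => \sum_(i <- r | P i) F i D z).
Proof.
move=> OF; apply/smooth_bigOP => n; apply: bigO_upto_sum => i Pi.
by move: n; apply/smooth_bigOP; apply: OF.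
Qed.

Lemma smooth_bigOM p1 p2 g h : smooth_bigO p1 g -> smooth_bigO p2 h ->
  smooth_bigO (p1 + p2) (fun D z => g D z * h D z).
Proof.
by move=> /smooth_bigOP Og /smooth_bigOP Oh; apply/smooth_bigOP => n; apply: bigO_uptoM.
Qed.

Lemma smooth_bigO_cst G : smooth_on setT G -> smooth_bigO 0 (fun _ : R => G).
Proof.
move=> sG; split=> [|vs K cK]; first exact: nearW.
have [|C GC] := compact_norm_bound K (iter_derive vs G) cK.
  by move=> z _; apply: smooth_continuous (iter_derive_smooth _ vs _ sG) _.
by exists C; apply: nearW => D z Kz; rewrite expr0 mulr1 GC.
Qed.

Lemma smooth_bigO_taylor n p g w : smooth_bigO p g ->
  smooth_bigO (n + p) (fun D z => g D (z + D *: w)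
    - \sum_(i < n) i`!%:R^-1 * D ^+ i * iter_derive (nseq i w) (g D) z).
Proof.
case=> sg Og.
have sT (D : R) (i : nat) : smooth_on setT (g D) -> smooth_on setT
    (fun z => - (i`!%:R^-1 * D ^+ i) * iter_derive (nseq i w) (g D) z).
  by move=> sgD; apply/smoothZ/iter_derive_smooth.
have E (D : R) z : g D (z + D *: w)
      - \sum_(i < n) i`!%:R^-1 * D ^+ i * iter_derive (nseq i w) (g D) z
    = g D (z + D *: w)
      + \sum_(i < n) - (i`!%:R^-1 * D ^+ i) * iter_derive (nseq i w) (g D) z.
  by rewrite -sumrN; under [in RHS]eq_bigr do rewrite mulNr.
split.
  apply: filterS sg => D sgD; under eq_fun do rewrite E.
  apply: smoothD; first exact: smooth_translate.
  by apply: smooth_sum => i _; apply: sT.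
move=> vs K cK.
(* The region swept by [K] along [w] during a unit time contains all intermediate points of Taylor's
   formula once [D <= 1], and is compact as a continuous image. *)
pose K' := (fun x : V * R => x.1 + x.2 *: w) @` (K `*` `[0, 1]%classic).
have cK' : compact K'.
  apply: continuous_compact; last by apply: compact_setX => //; apply: segment_compact.
  apply: continuous_subspaceT => x; apply: cvgD; first exact: cvg_fst.
  by apply: cvgZr_tmp; exact: cvg_snd.
(* For the [vs]-derivative of the remainder, the derivative to be bounded is the [n]-th one along
   [w] of [iter_derive vs (g D)]. *)
have [C gC] := Og (vs ++ nseq n w) K' cK'; exists C.
apply: (filterS2 _ _ (filterI sg gC) (filterI near_right_gt0 near_right_le1)).
move=> D [sgD gCD] [D0 D1] z Kz.
have DE (i : nat) : iter_derive vs (iter_derive (nseq i w) (g D)) =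
    iter_derive (nseq i w) (iter_derive vs (g D)) by apply: iter_derive_comm.
rewrite (_ : iter_derive vs _ z = iter_derive vs (g D) (z + D *: w)
    - \sum_(i < n) i`!%:R^-1 * D ^+ i * iter_derive (nseq i w) (iter_derive vs (g D)) z).
  rewrite addnC exprD mulrA; apply: taylor_bound; [exact: iter_derive_smooth|exact: ltW|].
  move=> c /andP[c0 cD]; rewrite -DE -[iter_derive vs _]foldr_cat; apply: gCD.
  exists (z, c) => //; split => //=; rewrite in_itv /= c0; exact: le_trans D1.
under eq_fun do rewrite E.
rewrite iter_deriveD; [|exact: smooth_translate|by apply: smooth_sum => i _; apply: sT].
rewrite iter_derive_translate iter_derive_sum; last by move=> i _; apply: sT.
rewrite -sumrN; congr (_ + _); apply: eq_bigr => i _.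
rewrite iter_deriveZ; last exact: iter_derive_smooth.
by rewrite DE mulNr.
Qed.

Lemma taylor1 p g w : smooth_bigO p g ->
  smooth_bigO p.+1 (fun D z => g D (z + D *: w) - g D z).
Proof.
move=> /(smooth_bigO_taylor 1 _ _ w); apply: smooth_bigO_eq; apply: nearW => D.
by apply/funext => z; rewrite big_ord1 expr0 invr1 !mul1r.
Qed.

Lemma taylor2 p g w : smooth_bigO p g ->
  smooth_bigO p.+2 (fun D z => g D (z + D *: w) - g D z - D * 'D_w (g D) z).
Proof.
move=> /(smooth_bigO_taylor 2 _ _ w); apply: smooth_bigO_eq; apply: nearW => D.
apply/funext => z; rewrite !big_ord_recl big_ord0 /= expr0 expr1 fact0 invr1 !mul1r.
by rewrite addr0 opprD addrA.
Qed.

Lemma taylor3 p g w : smooth_bigO p g ->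
  smooth_bigO p.+3 (fun D z => g D (z + D *: w) - g D z
    - D * ('D_w (g D) z + D / 2 * 'D_w ('D_w (g D)) z)).
Proof.
move=> /(smooth_bigO_taylor 3 _ _ w); apply: smooth_bigO_eq; apply: nearW => D.
apply/funext => z; rewrite !big_ord_recl big_ord0 /= expr0 expr1 fact0 invr1 !mul1r.
by rewrite (_ : 2`! = 2)%N //; field.
Qed.

End BigO.

(** * Compositions and matrices *)

Section BigOComposition.
Context {R : realType} {V U : normedModType R} {m : nat}.

(** [stays_in] confines the arguments over a compact set to one compact subset of [W], independent
    of small [D], on which [F] and each of its derivatives are bounded. The chain rule then
    propagates the bounds. *)
Lemma smooth_bigO_comp (W : set U) (F : U -> R) (e : 'I_m -> U) (c : 'I_m -> R -> V -> R) :
  smooth_on W F -> (forall i, smooth_bigO 0 (c i)) ->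
  stays_in W (fun D z => \sum_i c i D z *: e i) ->
  smooth_bigO 0 (fun D z => F (\sum_i c i D z *: e i)).
Proof.
move=> sF Oc [cW cK]; apply/smooth_bigOP => n.
have sc : \forall D \near 0^'+, forall i, smooth_on setT (c i D).
  by apply: filter_forall => i; case: (Oc i).
have O0 (G : U -> R) : smooth_on W G ->
    bigO_upto 0 0 (fun D z => G (\sum_i c i D z *: e i)).
  move=> sG; split.
    by apply: filterS2 cW sc => D WD scD; apply: smooth_comp sG scD WD.
  move=> [|//] K _ /cK[K' [cK' K'W] K'D].
  have [|C GC] := compact_norm_bound K' G cK'.
    by move=> z /K'W Wz; apply: smooth_continuous sG Wz.
  exists C; apply: filterS K'D => D K'D z Kz.
  by rewrite expr0 mulr1 GC //; apply: K'D.
elim: n F sF => [|n IHn] F sF; first exact: O0.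
apply: bigO_uptoS; first exact: O0.
move=> v.
apply: (@bigO_upto_eq _ _ _ _
  (fun D z => \sum_i 'D_(e i) F (\sum_i c i D z *: e i) * 'D_v (c i D) z)).
  apply: filterS2 cW sc => D WD scD; apply/funext => z.
  have dc i y : differentiable (c i D) y by apply: smooth_differentiable (scD i) _.
  by have [_] := derive_comp_sum _ _ e (c ^~ D) v z sF dc (WD z).
apply: bigO_upto_sum => i _; rewrite -[0%N]/(0 + 0)%N; apply: bigO_uptoM.
  exact: IHn (smooth_derive _ sF).
by move: n {IHn}; apply/smooth_bigOP/smooth_bigO_derive.
Qed.

End BigOComposition.

Section SmoothMatrices.
Context {R : realType} {V : normedModType R}.

Lemma smooth_prod (I : Type) (r : seq I) (P : pred I) (F : I -> V -> R) :
  (forall i, P i -> smooth_on setT (F i)) ->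
  smooth_on setT (fun z => \prod_(i <- r | P i) F i z).
Proof.
move=> sF; elim: r => [|i r IHr].
  rewrite (_ : (fun z => _) = fun=> 1); first exact: smooth_cst.
  by apply/funext => z; rewrite big_nil.
case Pi: (P i).
  rewrite (_ : (fun z => _) = fun z => F i z * \prod_(j <- r | P j) F j z).
    by apply: smoothM => //; apply: sF.
  by apply/funext => z; rewrite big_cons Pi.
rewrite (_ : (fun z => _) = fun z => \prod_(j <- r | P j) F j z) //.
by apply/funext => z; rewrite big_cons Pi.
Qed.

Lemma smoothX (k : nat) (g : V -> R) : smooth_on setT g -> smooth_on setT (fun z => g z ^+ k).
Proof.
move=> sg; elim: k => [|k IHk]; first by under eq_fun do rewrite expr0; exact: smooth_cst.
by under eq_fun do rewrite exprS; exact: smoothM.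
Qed.

Lemma smooth_det (n : nat) (A : V -> 'M[R]_n) :
  (forall i j, smooth_on setT (fun z => A z i j)) -> smooth_on setT (fun z => \det (A z)).
Proof.
move=> sA; apply: smooth_sum => s _; apply: smoothZ.
by apply: smooth_prod => i _; apply: sA.
Qed.

Lemma smooth_invmx (n : nat) (A : V -> 'M[R]_n) :
  (forall i j, smooth_on setT (fun z => A z i j)) -> (forall z, A z \in unitmx) ->
  forall i j, smooth_on setT (fun z => invmx (A z) i j).
Proof.
move=> sA uA i j.
(* Cramer's formula reduces the inverse to determinants; the cofactor indices are transposed, as in
   the adjugate. *)
rewrite (_ : (fun z => _) = fun z => (\det (A z))^-1 *
    ((-1) ^+ (j + i) * \det (row' j (col' i (A z))))); last first.
  by apply/funext => z; rewrite /invmx uA !mxE.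
apply: smoothM; last first.
  by apply/smoothZ/smooth_det => k l; under eq_fun do rewrite !mxE; apply: sA.
apply: smoothV; first exact: smooth_det.
by move=> z; rewrite -unitfE -unitmxE.
Qed.

Lemma smooth_meval (n : nat) (p : mpoly.mpoly n R) (x : V -> 'I_n -> R) :
  (forall i, smooth_on setT (fun z => x z i)) -> smooth_on setT (fun z => mpoly.meval (x z) p).
Proof.
move=> sx; under eq_fun do rewrite mpoly.mevalE.
apply: smooth_sum => k _; apply: smoothZ; apply: smooth_prod => i _.
exact: smoothX.
Qed.

End SmoothMatrices.

(** * Balance laws *)

Section Balance.
Context {R : realType} {d q : nat} (v : 'I_q -> 'rV[R]_d).

Local Notation V := ('rV[R]_d * R)%type.
Local Notation "'w_ j" := ((v j, 1) : V) (at level 8, j at level 2, format "''w_' j").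

(** Viewing transport as a derivative in the single space-time direction [(w, 1)] makes Taylor's
    formula along characteristics a one-dimensional statement. *)
Lemma d_alongE (w : 'rV[R]_d) (g : V -> R) z : differentiable g z ->
  d_along w g z = 'D_((w, 1) : V) g z.
Proof.
move=> dg; rewrite /d_along /d_t /d_x.
have -> : ((w, 1) : V) = (0, 1) + \sum_(c < d) w 0 c *: ((delta_mx 0 c, 0) : V).
  rewrite [LHS]surjective_pairing [RHS]surjective_pairing; congr (_, _) => /=.
    rewrite (raddf_sum fst) add0r /= [LHS]row_sum_delta.
    by apply: eq_bigr.
  by rewrite (raddf_sum snd) big1 ?addr0 // => c _ /=; rewrite scaler0.
rewrite !deriveE // linearD linear_sum; congr (_ + _); apply: eq_bigr => c _.
by rewrite linearZ /= deriveE.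
Qed.

(** The weights and velocities are constants, so they pass under the derivatives: weighted transport
    becomes the time derivative of a moment plus the divergence of the next one. *)
Lemma transport_split (F : 'I_q -> V -> R) (c : 'I_q -> R) z :
  (forall j, smooth_on setT (F j)) ->
  \sum_j c j * 'D_('w_j) (F j) z =
    d_t (fun y => \sum_j c j * F j y) z
    + \sum_(b < d) d_x b (fun y => \sum_j c j * v j 0 b * F j y) z.
Proof.
move=> sF.
have dE (u : V) (a : 'I_q -> R) :
    'D_u (fun y => \sum_j a j * F j y) z = \sum_j a j * 'D_u (F j) z.
  have := iter_derive_sum [:: u] _ (index_enum 'I_q) xpredT (fun j y => a j * F j y).
  move=> /(_ (fun j _ => smoothZ (a j) _ (sF j)))/(congr1 (@^~ z)) /= ->.
  apply: eq_bigr => j _.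
  by have := congr1 (@^~ z) (iter_deriveZ [:: u] (a j) _ (sF j)).
rewrite /d_t dE; under [X in _ + X]eq_bigr do rewrite /d_x dE.
rewrite exchange_big -big_split /=; apply: eq_bigr => j _.
rewrite -d_alongE; last exact: smooth_differentiable (sF j) _.
rewrite /d_along mulrDr mulr_sumr; congr (_ + _); apply: eq_bigr => b _.
by rewrite mulrA.
Qed.

Section Conservation.
Context (F : 'I_q -> R -> V -> R) (c : 'I_q -> R).

Lemma conservation_order1 : (forall j, smooth_bigO 0 (F j)) ->
  (\forall D \near 0^'+, forall z, \sum_j c j * (F j D (z + D *: 'w_j) - F j D z) = 0) ->
  smooth_bigO 1 (fun D z => \sum_j c j * 'D_('w_j) (F j D) z).
Proof.
move=> OF F0; apply: (smooth_bigO_divX _ 1).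
(* Adding the vanishing sum [F0] to minus the Taylor remainders leaves exactly [D] times the claimed
   quantity. *)
have : smooth_bigO 2 (fun D z => \sum_j - c j *
    (F j D (z + D *: 'w_j) - F j D z - D * 'D_('w_j) (F j D) z)).
  by apply: smooth_bigO_sum => j _; apply/smooth_bigO_scale/taylor2.
apply: smooth_bigO_eq; apply: filterS F0 => D F0; apply/funext => z.
rewrite expr1 -[LHS]addr0 -[X in _ + X](F0 z) -big_split mulr_sumr /=; apply: eq_bigr => j _.
by ring.
Qed.

Lemma conservation_order2 : (forall j, smooth_bigO 0 (F j)) ->
  (\forall D \near 0^'+, forall z, \sum_j c j * (F j D (z + D *: 'w_j) - F j D z) = 0) ->
  smooth_bigO 2 (fun D z => \sum_j c j *
    ('D_('w_j) (F j D) z + D / 2 * 'D_('w_j) ('D_('w_j) (F j D)) z)).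
Proof.
move=> OF F0; apply: (smooth_bigO_divX _ 1).
have : smooth_bigO 3 (fun D z => \sum_j - c j *
    (F j D (z + D *: 'w_j) - F j D z
    - D * ('D_('w_j) (F j D) z + D / 2 * 'D_('w_j) ('D_('w_j) (F j D)) z))).
  by apply: smooth_bigO_sum => j _; apply/smooth_bigO_scale/taylor3.
apply: smooth_bigO_eq; apply: filterS F0 => D F0; apply/funext => z.
rewrite expr1 -[LHS]addr0 -[X in _ + X](F0 z) -big_split mulr_sumr /=; apply: eq_bigr => j _.
by ring.
Qed.

(** [G] stands for any expression of the flux correct up to O(D^2): the momentum itself for mass,
    the equilibrium flux with its viscous correction for momentum. *)
Lemma balance_law (G : 'I_d -> R -> V -> R) : (forall j, smooth_bigO 0 (F j)) ->
  (\forall D \near 0^'+, forall z, \sum_j c j * (F j D (z + D *: 'w_j) - F j D z) = 0) ->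
  (forall b, smooth_bigO 2 (fun D z => G b D z
     - \sum_j c j * v j 0 b * (F j D z + D / 2 * 'D_('w_j) (F j D) z))) ->
  smooth_bigO 2 (fun D z => d_t (fun y => \sum_j c j * F j D y) z
    + \sum_(b < d) d_x b (G b D) z).
Proof.
move=> OF F0 OG.
have O1 := smooth_bigO_derive _ _ ((0, 1) : V) (conservation_order1 OF F0).
(* The factor [- D / 2] cancels the time derivative that [transport_split] extracts from the
   second-order Taylor term. *)
have O1h := smooth_bigO_mulX _ 1 _ (smooth_bigO_scale _ (- 2^-1) _ O1).
have O2 := conservation_order2 OF F0.
have O3 : smooth_bigO 2 (fun D z => \sum_(b < d) d_x b (fun z => G b D z
     - \sum_j c j * v j 0 b * (F j D z + D / 2 * 'D_('w_j) (F j D) z)) z).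
  by apply: smooth_bigO_sum => b _; apply: smooth_bigO_derive (OG b).
apply: smooth_bigO_eq (smooth_bigOD _ _ _ (smooth_bigOD _ _ _ O1h O2) O3).
have sF : \forall D \near 0^'+, forall j, smooth_on setT (F j D).
  by apply: filter_forall => j; case: (OF j).
have sG : \forall D \near 0^'+, forall b, smooth_on setT (fun z => G b D z
     - \sum_j c j * v j 0 b * (F j D z + D / 2 * 'D_('w_j) (F j D) z)).
  by apply: filter_forall => b; case: (OG b).
apply: filterS2 sF sG => D sF sG; apply/funext => z.
have sDF j : smooth_on setT ('D_('w_j) (F j D)) := smooth_derive _ (sF j).
have sA b : smooth_on setT (fun z => \sum_j c j * v j 0 b * F j D z).
  by apply: smooth_sum => j _; apply: smoothZ.
have sB b : smooth_on setT (fun z => \sum_j c j * v j 0 b * 'D_('w_j) (F j D) z).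
  by apply: smooth_sum => j _; apply: smoothZ.
have sAB b : smooth_on setT (fun z =>
    \sum_j c j * v j 0 b * (F j D z + D / 2 * 'D_('w_j) (F j D) z)).
  by apply: smooth_sum => j _; apply/smoothZ/smoothD => //; apply: smoothZ.
have GE b : d_x b (G b D) z = d_x b (fun z => G b D z
       - \sum_j c j * v j 0 b * (F j D z + D / 2 * 'D_('w_j) (F j D) z)) z
    + (d_x b (fun z => \sum_j c j * v j 0 b * F j D z) z
       + D / 2 * d_x b (fun z => \sum_j c j * v j 0 b * 'D_('w_j) (F j D) z) z).
  pose u : V := (delta_mx 0 b, 0).
  have E1 := congr1 (@^~ z) (iter_deriveD [:: u] _ _ (sG b) (sAB b)).
  have E2 := congr1 (@^~ z) (iter_deriveD [:: u] _ _ (sA b) (smoothZ (D / 2) _ (sB b))).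
  have E3 := congr1 (@^~ z) (iter_deriveZ [:: u] (D / 2) _ (sB b)).
  move: E1 E2 E3; rewrite /= => E1 E2 E3.
  rewrite /d_x -/u -[X in _ + (_ + X)]E3 -[X in _ + X]E2.
  (* The smoothness of [G] itself is obtained from that of its difference with the expanded flux. *)
  have -> : G b D = fun z => G b D z -
      \sum_j c j * v j 0 b * (F j D z + D / 2 * 'D_('w_j) (F j D) z) +
      \sum_j c j * v j 0 b * (F j D z + D / 2 * 'D_('w_j) (F j D) z).
    by apply/funext => y; rewrite subrK.
  rewrite E1; under [in RHS]eq_fun do rewrite subrK.
  congr (_ + 'D_u _ z); apply/funext => y.
  rewrite mulr_sumr -big_split; apply: eq_bigr => j _ /=.
  by ring.
under [X in _ = _ + X]eq_bigr do rewrite GE.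
rewrite !big_split /= -mulr_sumr.
have T1 := transport_split _ c z sF.
have T2 := transport_split _ c z sDF.
under [X in _ + X + _]eq_bigr do rewrite mulrDr mulrCA.
rewrite big_split -mulr_sumr /= T1 T2 /d_t.
by ring.
Qed.

End Conservation.
End Balance.

(** * Moments of the scheme *)

Section SchemeMoments.
Context {R : realType} {d q : nat}.
Context (P : 'I_q -> mpoly.mpoly d R) (v : 'I_q -> 'rV[R]_d).
Context (hq : (d.+1 <= q)%N)
  (hP : moment_polynomials P).

Local Notation "'w_ j" := ((v j, 1) : 'rV[R]_d * R) (at level 8, j at level 2, format "''w_' j").

(** The conserved moments are the density and the momentum minus [u] times the density. This change
    of variables is invertible for each [u], so their vanishing means the same at every relative
    velocity. *)
Lemma moment_mx_conserved (u : 'rV[R]_d) (f : 'cV[R]_q) :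
  (forall k : 'I_q, (k <= d)%N -> (moment_mx P v u *m f) k 0 = 0) <-> conserved v f = 0.
Proof.
case: hP => P0 PS _.
have M0 (k : 'I_q) : k = 0%N :> nat -> (moment_mx P v u *m f) k 0 = density f.
  move=> k0; rewrite mxE; apply: eq_bigr => j _.
  by rewrite mxE P0 // mpoly.meval1 mul1r.
have MS (k : 'I_q) (a : 'I_d) : k = a.+1 :> nat ->
    (moment_mx P v u *m f) k 0 = momentum v f 0 a - u 0 a * density f.
  move=> ka; rewrite !mxE mulr_sumr -sumrB; apply: eq_bigr => j _.
  by rewrite !mxE (PS k a ka) mpoly.mevalXU !mxE mulrBl.
split=> [Mf0 | [rho0 mom0] k].
  have rho0 : density f = 0.
    by rewrite -(M0 (Ordinal (leq_trans (ltn0Sn d) hq))) ?Mf0.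
  congr (_, _) => //; apply/rowP => a.
  have ad : (a.+1 < q)%N by apply: leq_trans hq; rewrite ltnS.
  have := MS (Ordinal ad) a erefl; rewrite rho0 mulr0 subr0 => <-.
  by rewrite Mf0 ?mxE //=.
case: (posnP k) => [k0 _|k0 kd]; first by rewrite M0.
have kd' : (k.-1 < d)%N by rewrite prednK.
by rewrite (MS k (Ordinal kd')) /= ?prednK // rho0 mom0 mxE mulr0 subr0.
Qed.

(** This is the form required by the chain rule of [smooth_bigO_comp]. *)
Lemma conserved_sum (f : 'cV[R]_q) :
  conserved v f = \sum_j f j 0 *: ((1, v j) : R * 'rV[R]_d).
Proof.
rewrite [RHS]surjective_pairing (raddf_sum fst) (raddf_sum snd) /=; congr (_, _).
  by apply: eq_bigr => j _; rewrite /= -[RHS]/(_ * _) mulr1.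
by apply/rowP => a; rewrite mxE summxE; apply: eq_bigr => j _; rewrite mxE mulrC.
Qed.

Lemma conservedB (f g : 'cV[R]_q) : conserved v (f - g) = conserved v f - conserved v g.
Proof.
rewrite !conserved_sum -sumrB; apply: eq_bigr => j _.
by rewrite !mxE scalerBl.
Qed.

Lemma relaxedE (s : 'I_q -> R) (M : 'M[R]_q) (f fe : 'cV[R]_q) : M \in unitmx ->
  M *m (relaxed s M f fe - f) = \col_k (s k * (M *m (fe - f)) k 0).
Proof.
move=> uM; rewrite mulmxBr mulKVmx // mulmxBr; apply/colP => k.
by rewrite !mxE addrAC subrr add0r.
Qed.

(** Reading the transport from the departure point [z] makes all components share one collision, so
    a single matrix [M(ut z)] applies to the whole increment. *)
Lemma scheme_moments (s : 'I_q -> R) (ut : 'rV[R]_d * R -> 'rV[R]_d)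
    (feq : R * 'rV[R]_d -> 'cV[R]_q) (D : R) (f : 'rV[R]_d * R -> 'cV[R]_q) z :
  moment_mx P v (ut z) \in unitmx -> satisfies_scheme P v s ut feq D f ->
  moment_mx P v (ut z) *m (\col_j (f (z + D *: 'w_j) j 0 - f z j 0)) =
  \col_k (s k * (moment_mx P v (ut z) *m (equilibrium v feq f z - f z)) k 0).
Proof.
move=> uM sch; rewrite -relaxedE //; congr (_ *m _); apply/colP => j.
rewrite mxE [RHS]mxE [X in _ = _ + X]mxE; congr (_ - _).
case: z uM => x t uM.
have -> : (x, t) + D *: 'w_j = (x + D *: v j, t + D).
  by congr (_, _); rewrite /= -[D *: 1]/(D * 1) mulr1.
by rewrite sch /post_collision addrK.
Qed.

End SchemeMoments.

(** * Relaxation towards equilibrium *)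

Section Relaxation.
Context {R : realType} {V : normedModType R} {q : nat} (d : nat).
Context (w : 'I_q -> V) (s : 'I_q -> R).
Context (hs0 : forall k : 'I_q, (k <= d)%N -> s k = 0).
Context (hs : forall k : 'I_q, (d < k)%N -> s k != 0).
Context (M N : 'I_q -> 'I_q -> V -> R).
Context (sM : forall k j, smooth_on setT (M k j)).
Context (sN : forall j k, smooth_on setT (N j k)).
Context (NM : forall z j i, \sum_k N j k z * M k i z = (j == i)%:R).
Context (F E : 'I_q -> R -> V -> R).
Context (OF : forall j, smooth_bigO 0 (F j)) (OE : forall j, smooth_bigO 0 (E j)).

Let gap k D z := \sum_j M k j z * (E j D z - F j D z).
Let theta k D z := \sum_j M k j z * 'D_(w j) (E j D) z.

Context (relaxation : \forall D \near 0^'+, forall z k,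
  \sum_j M k j z * (F j D (z + D *: w j) - F j D z) = s k * gap k D z).
Context (gap_conserved : \forall D \near 0^'+, forall z (k : 'I_q), (k <= d)%N -> gap k D z = 0).

Let mulmxK (x : 'I_q -> R) z j : \sum_k N j k z * (\sum_i M k i z * x i) = x j.
Proof.
under eq_bigr do rewrite mulr_sumr.
rewrite exchange_big /= (bigD1 j) //= [X in _ + X]big1 => [|i ij].
  by under eq_bigr do rewrite mulrA; rewrite -mulr_suml NM eqxx mul1r addr0.
by under eq_bigr do rewrite mulrA; rewrite -mulr_suml NM eq_sym (negPf ij) mul0r.
Qed.

Let OM p k j g : smooth_bigO p g -> smooth_bigO p (fun D z => M k j z * g D z).
Proof. by move=> Og; apply: (smooth_bigOM 0) => //; apply: smooth_bigO_cst. Qed.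

Let ON p j k g : smooth_bigO p g -> smooth_bigO p (fun D z => N j k z * g D z).
Proof. by move=> Og; apply: (smooth_bigOM 0) => //; apply: smooth_bigO_cst. Qed.

Lemma gap_bigO1 k : smooth_bigO 1 (gap k).
Proof.
case: (leqP k d) => kd.
  apply: smooth_bigO_eq (smooth_bigO0 1); apply: filterS gap_conserved => D gap0.
  by apply/funext => z; rewrite gap0.
have : smooth_bigO 1 (fun D z => (s k)^-1 *
    \sum_j M k j z * (F j D (z + D *: w j) - F j D z)).
  by apply/smooth_bigO_scale/smooth_bigO_sum => j _; apply/OM/taylor1.
apply: smooth_bigO_eq; apply: filterS relaxation => D rel.
by apply/funext => z; rewrite rel mulKf // hs.
Qed.

Lemma nonequilibrium_bigO1 j : smooth_bigO 1 (fun D z => E j D z - F j D z).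
Proof.
have : smooth_bigO 1 (fun D z => \sum_k N j k z * gap k D z).
  by apply: smooth_bigO_sum => k _; apply/ON/gap_bigO1.
apply: smooth_bigO_eq; apply: nearW => D; apply/funext => z.
exact: (mulmxK (fun i => E i D z - F i D z)).
Qed.

Lemma derive_nonequilibrium_bigO1 j :
  smooth_bigO 1 (fun D z => 'D_(w j) (E j D) z - 'D_(w j) (F j D) z).
Proof.
apply: smooth_bigO_eq (smooth_bigO_derive _ _ (w j) (nonequilibrium_bigO1 j)).
apply: filterS2 (OE j).1 (OF j).1 => D sE sF; apply/funext => z.
by apply: deriveB; apply: diff_derivable;
  [exact: smooth_differentiable sE _|exact: smooth_differentiable sF _].
Qed.

Lemma gap_order2 k : smooth_bigO 2 (fun D z => s k * gap k D z - D * theta k D z).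
Proof.
(* Two replacements are made, each costing O(D^2): the increment by [D] times the derivative of [F],
   then the derivative of [F] by that of [E]. *)
have : smooth_bigO 2 (fun D z =>
    (\sum_j M k j z * (F j D (z + D *: w j) - F j D z - D * 'D_(w j) (F j D) z))
    - D ^+ 1 * \sum_j M k j z * ('D_(w j) (E j D) z - 'D_(w j) (F j D) z)).
  apply: smooth_bigOB.
    by apply: smooth_bigO_sum => j _; apply/OM/taylor2.
  apply: (smooth_bigO_mulX 1 1); apply: smooth_bigO_sum => j _.
  exact/OM/derive_nonequilibrium_bigO1.
apply: smooth_bigO_eq; apply: filterS relaxation => D rel; apply/funext => z.
rewrite -rel /theta expr1 !mulr_sumr -!sumrB; apply: eq_bigr => j _.
by ring.
Qed.

(** These are the first-order conservation laws at equilibrium, obtained from [gap_order2] because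
    the relaxation term disappears with [s k]. *)
Lemma theta_bigO1 (k : 'I_q) : (k <= d)%N -> smooth_bigO 1 (theta k).
Proof.
move=> kd; apply: (smooth_bigO_divX 1 1).
apply: smooth_bigO_eq (smooth_bigON _ _ (gap_order2 k)); apply: nearW => D.
by apply/funext => z; rewrite hs0 // mul0r sub0r opprK expr1.
Qed.

Lemma flux_expansion (p : 'I_q -> R) :
  smooth_bigO 2 (fun D z => \sum_j p j * E j D z
    - D * (\sum_(l < q | (d < l)%N) ((s l)^-1 - 2^-1) *
             ((\sum_j p j * N j l z) * theta l D z))
    - \sum_j p j * (F j D z + D / 2 * 'D_(w j) (F j D) z)).
Proof.
pose L l z := \sum_j p j * N j l z.
have OL n l g : smooth_bigO n g -> smooth_bigO n (fun D z => L l z * g D z).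
  move=> Og; apply: (smooth_bigOM 0) => //; apply: smooth_bigO_cst.
  by apply: smooth_sum => j _; apply: smoothZ.
(* Inserting [N M = 1] expresses any [p]-weighted sum through moments; with [p j = v_j^a v_j^b], [L]
   is [Lambda]. *)
have LE (x : 'I_q -> R) z : \sum_l L l z * (\sum_j M l j z * x j) = \sum_j p j * x j.
  under eq_bigr do rewrite mulr_suml.
  rewrite exchange_big /=; apply: eq_bigr => j _.
  by under eq_bigr do rewrite -mulrA; rewrite -mulr_sumr mulmxK.
(* The whole error has three sources: the expansion of the gap, the passage from [F] to [E] in the
   half-step term, and the discarded [theta_l] with [l <= d]. *)
have : smooth_bigO 2 (fun D z =>
    (\sum_(l < q | (d < l)%N) L l z * ((s l)^-1 * (s l * gap l D z - D * theta l D z)))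
    + D ^+ 1 * ((\sum_j (p j / 2) * ('D_(w j) (E j D) z - 'D_(w j) (F j D) z))
        - \sum_(l < q | ~~ (d < l)%N) L l z * (2^-1 * theta l D z))).
  apply: smooth_bigOD.
    by apply: smooth_bigO_sum => l _; apply/OL/smooth_bigO_scale/gap_order2.
  apply: (smooth_bigO_mulX 1 1); apply: smooth_bigOB.
    by apply: smooth_bigO_sum => j _; apply/smooth_bigO_scale/derive_nonequilibrium_bigO1.
  apply: smooth_bigO_sum => l; rewrite -leqNgt => ld.
  exact/OL/smooth_bigO_scale/theta_bigO1.
apply: smooth_bigO_eq; apply: filterS gap_conserved => D gap0; apply/funext => z.
have gapE : \sum_(l < q | (d < l)%N) L l z * gap l D z = \sum_j p j * (E j D z - F j D z).
  rewrite -(LE (fun j => E j D z - F j D z) z) [RHS](bigID (fun l : 'I_q => (d < l)%N)) /=.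
  rewrite [X in _ = _ + X]big1 ?addr0 // => l; rewrite -leqNgt => ld.
  by rewrite -[X in _ * X]/(gap l D z) gap0 // mulr0.
have thetaE : \sum_(l < q | ~~ (d < l)%N) L l z * theta l D z =
    \sum_j p j * 'D_(w j) (E j D) z - \sum_(l < q | (d < l)%N) L l z * theta l D z.
  rewrite -(LE (fun j => 'D_(w j) (E j D) z) z)
    [X in _ = X - _](bigID (fun l : 'I_q => (d < l)%N)) /=.
  by rewrite addrAC subrr add0r.
have -> : \sum_(l < q | (d < l)%N) L l z * ((s l)^-1 * (s l * gap l D z - D * theta l D z))
    = \sum_j p j * (E j D z - F j D z)
      - D * \sum_(l < q | (d < l)%N) (s l)^-1 * (L l z * theta l D z).
  rewrite -gapE mulr_sumr -sumrB; apply: eq_bigr => l dl.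
  by have sl := hs l dl; field.
have -> : \sum_(l < q | ~~ (d < l)%N) L l z * (2^-1 * theta l D z) =
    2^-1 * \sum_(l < q | ~~ (d < l)%N) L l z * theta l D z.
  by rewrite mulr_sumr; apply: eq_bigr => l _; ring.
have -> : \sum_(l < q | (d < l)%N) ((s l)^-1 - 2^-1) * (L l z * theta l D z) =
    \sum_(l < q | (d < l)%N) (s l)^-1 * (L l z * theta l D z)
    - 2^-1 * \sum_(l < q | (d < l)%N) L l z * theta l D z.
  by rewrite mulr_sumr -sumrB; apply: eq_bigr => l _; ring.
have -> : \sum_j p j * (E j D z - F j D z) = \sum_j p j * E j D z - \sum_j p j * F j D z.
  by rewrite -sumrB; apply: eq_bigr => j _; ring.
have -> : \sum_j p j / 2 * ('D_(w j) (E j D) z - 'D_(w j) (F j D) z) =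
    2^-1 * \sum_j p j * 'D_(w j) (E j D) z - 2^-1 * \sum_j p j * 'D_(w j) (F j D) z.
  by rewrite !mulr_sumr -sumrB; apply: eq_bigr => j _; ring.
have -> : \sum_j p j * (F j D z + D / 2 * 'D_(w j) (F j D) z) =
    \sum_j p j * F j D z + D / 2 * \sum_j p j * 'D_(w j) (F j D) z.
  by rewrite mulr_sumr -big_split; apply: eq_bigr => j _ /=; ring.
by rewrite thetaE; field.
Qed.

End Relaxation.

(** * Application of the expansions to mass and momentum *)

Theorem mainTheorem6 (R : realType) (d q : nat) (hd : (1 <= d)%N) (hq : (d.+1 <= q)%N)
  (v : 'I_q -> 'rV[R]_d) (P : 'I_q -> mpoly.mpoly d R) (hP : moment_polynomials P)
  (hM : forall u : 'rV[R]_d, moment_mx P v u \in unitmx)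
  (s : 'I_q -> R)
  (hs0 : forall k : 'I_q, (k <= d)%N -> s k = 0)
  (hs : forall k : 'I_q, (d < k)%N -> s k != 0)
  (ut : 'rV[R]_d * R -> 'rV[R]_d)
  (hut : forall a : 'I_d, smooth_on setT (fun z => ut z 0 a))
  (W : set (R * 'rV[R]_d)%type) (hW : open W)
  (feq : R * 'rV[R]_d -> 'cV[R]_q)
  (hfeq : forall j : 'I_q, smooth_on W (fun w => feq w j 0))
  (hfeq_cons : forall w : R * 'rV[R]_d, W w -> conserved v (feq w) = w)
  (f : R -> 'rV[R]_d * R -> 'cV[R]_q)
  (hf : forall j : 'I_q, smooth_bigO 0 (fun D z => f D z j 0))
  (hfW : stays_in W (fun D z => conserved v (f D z)))
  (hscheme : \forall D \near 0^'+, satisfies_scheme P v s ut feq D (f D)) :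
  smooth_bigO 2 (fun D z =>
    d_t (fun y => density (f D y)) z
    + \sum_(b < d) d_x b (fun y => momentum v (f D y) 0 b) z)
  /\
  forall a : 'I_d, smooth_bigO 2 (fun D z =>
    d_t (fun y => momentum v (f D y) 0 a) z
    + \sum_(b < d) d_x b (fun y => momentum_flux v (equilibrium v feq (f D) y) a b) z
    - D * \sum_(b < d) \sum_(l < q | (d < l)%N) sigma s l *
        d_x b (fun y => Lambda P v a b l (ut y)
                        * theta P v ut (equilibrium v feq (f D)) l y) z).
Proof.
pose w j : ('rV[R]_d * R)%type := (v j, 1).
pose F j D z := f D z j 0.
pose E j D z := equilibrium v feq (f D) z j 0.
pose M k j z := moment_mx P v (ut z) k j.
pose N j k z := invmx (moment_mx P v (ut z)) j k.
have sM k j : smooth_on setT (M k j).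
  rewrite /M; under eq_fun do rewrite mxE.
  apply: smooth_meval => a; under eq_fun do rewrite !mxE.
  apply: smoothD; first exact: smooth_cst.
  by under eq_fun do rewrite -mulN1r; exact: smoothZ.
have sN j k : smooth_on setT (N j k) by apply: smooth_invmx.
have NM z j i : \sum_k N j k z * M k i z = (j == i)%:R.
  by have := mulVmx (hM (ut z)) => /matrixP/(_ j i); rewrite !mxE.
have OF j : smooth_bigO 0 (F j) by apply: hf.
pose e j : (R * 'rV[R]_d)%type := (1, v j).
have consE D z : conserved v (f D z) = \sum_j F j D z *: e j by rewrite conserved_sum.
have OE j : smooth_bigO 0 (E j).
  have EE D : (fun z => feq (\sum_j F j D z *: e j) j 0) = E j D.
    by apply/funext => z; rewrite -consE.
  have := smooth_bigO_comp W (fun x => feq x j 0) e F (hfeq j) OF.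
  move=> OEj; apply: smooth_bigO_eq (OEj _); first by apply: nearW => D; exact: EE.
  rewrite (_ : (fun D z => _) = fun D z => conserved v (f D z)) //.
  by apply/funext => D; apply/funext => z; rewrite consE.
have rel : \forall D \near 0^'+, forall z k,
    \sum_j M k j z * (F j D (z + D *: w j) - F j D z) =
    s k * \sum_j M k j z * (E j D z - F j D z).
  apply: filterS hscheme => D sch z k.
  have /matrixP/(_ k 0) := scheme_moments _ _ _ _ _ _ _ z (hM (ut z)) sch.
  rewrite mxE [LHS]mxE [X in _ = _ * X]mxE => H; apply: etrans (etrans _ H) _.
    by apply: eq_bigr => j _; congr (_ * _); rewrite mxE.
  by congr (_ * _); apply: eq_bigr => j _; congr (_ * _); rewrite !mxE.
have gap0 : \forall D \near 0^'+, forall z (k : 'I_q), (k <= d)%N ->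
    \sum_j M k j z * (E j D z - F j D z) = 0.
  apply: filterS hfW.1 => D WD z k kd.
  have : conserved v (equilibrium v feq (f D) z - f D z) = 0.
    by rewrite conservedB hfeq_cons ?subrr.
  move/(moment_mx_conserved _ _ hq hP (ut z))/(_ k kd); rewrite mxE => H.
  by rewrite -[RHS]H; apply: eq_bigr => j _; congr (_ * _); rewrite !mxE.
(* Vanishing of the first [d + 1] moments of the increment, due to [s k = 0], is converted back into
   exact conservation of mass and momentum, free of [ut]. *)
have phi0 : \forall D \near 0^'+, forall z,
    conserved v (\col_j (F j D (z + D *: w j) - F j D z)) = 0.
  apply: filterS rel => D relD z; apply/(moment_mx_conserved _ _ hq hP (ut z)) => k kd.
  rewrite mxE; transitivity (s k * \sum_j M k j z * (E j D z - F j D z)).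
    by rewrite -relD; apply: eq_bigr => j _; congr (_ * _); rewrite mxE.
  by rewrite hs0 // mul0r.
have mass0 : \forall D \near 0^'+, forall z,
    \sum_j 1 * (F j D (z + D *: w j) - F j D z) = 0.
  apply: filterS phi0 => D phi0 z; have := congr1 fst (phi0 z) => /= H.
  by rewrite -[RHS]H /density; apply: eq_bigr => j _; rewrite mul1r mxE.
have mom0 a : \forall D \near 0^'+, forall z,
    \sum_j v j 0 a * (F j D (z + D *: w j) - F j D z) = 0.
  apply: filterS phi0 => D phi0 z; have /rowP/(_ a) := congr1 snd (phi0 z).
  by rewrite !mxE => H; rewrite -[RHS]H; apply: eq_bigr => j _; rewrite mxE.
split=> [|a].
  (* The mass flux is itself conserved, so its half-step correction is [D / 2] times an O(D). Hence
     no dissipative term in the mass equation. *)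
  have OG b : smooth_bigO 2 (fun D z => momentum v (f D z) 0 b
      - \sum_j 1 * v j 0 b * (F j D z + D / 2 * 'D_(w j) (F j D) z)).
    have O1 := conservation_order1 v F (fun j => v j 0 b) OF (mom0 b).
    apply: smooth_bigO_eq (smooth_bigO_mulX 1 1 _ (smooth_bigO_scale _ (- 2^-1) _ O1)).
    apply: nearW => D; apply/funext => z.
    by rewrite mxE expr1 !mulr_sumr -sumrB; apply: eq_bigr => j _; rewrite /F; field.
  have := balance_law v F (fun=> 1) _ OF mass0 OG.
  apply: smooth_bigO_eq; apply: nearW => D; apply/funext => z.
  by congr (d_t _ z + _); apply/funext => y; apply: eq_bigr => j _; rewrite mul1r.
have := balance_law v F (fun j => v j 0 a) _ OF (mom0 a)
  (fun b => flux_expansion d w s hs0 hs M N sM sN NM F E OF OE rel gap0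
              (fun j => v j 0 a * v j 0 b)).
have sE : \forall D \near 0^'+, forall j, smooth_on setT (E j D).
  by apply: filter_forall => j; case: (OE j).
apply: smooth_bigO_eq; apply: filterS sE => D sE; apply/funext => z.
have thetaE l : theta P v ut (equilibrium v feq (f D)) l =
    fun y => \sum_j M l j y * 'D_(w j) (E j D) y.
  apply/funext => y; apply: eq_bigr => j _; rewrite d_alongE //.
  exact: smooth_differentiable (sE j) _.
pose X b l y := Lambda P v a b l (ut y) * theta P v ut (equilibrium v feq (f D)) l y.
have sX b l : smooth_on setT (X b l).
  rewrite /X thetaE; apply: smoothM; apply: smooth_sum => j _; first exact: (smoothZ _ _ (sN j l)).
  by apply: smoothM => //; apply: smooth_derive.
have sXs b (l : 'I_q) : smooth_on setT (fun y => sigma s l * X b l y) by apply: smoothZ.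
have sXsum b : smooth_on setT (fun y => \sum_(l < q | (d < l)%N) sigma s l * X b l y).
  exact: smooth_sum.
have sflux b : smooth_on setT (fun y => momentum_flux v (equilibrium v feq (f D) y) a b).
  exact: smooth_sum (fun j _ => smoothZ _ _ (sE j)).
(* The balance law differentiates the corrected flux as a whole; smoothness of each [X b l] allows
   the derivative to be distributed over its terms. *)
have dG b : d_x b (fun y => momentum_flux v (equilibrium v feq (f D) y) a b
      + - D * \sum_(l < q | (d < l)%N) sigma s l * X b l y) z =
    d_x b (fun y => momentum_flux v (equilibrium v feq (f D) y) a b) z
    - D * \sum_(l < q | (d < l)%N) sigma s l * d_x b (X b l) z.
  pose u : ('rV[R]_d * R)%type := (delta_mx 0 b, 0).
  have E1 := congr1 (@^~ z) (iter_deriveD [:: u] _ _ (sflux b) (smoothZ (- D) _ (sXsum b))).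
  have E2 := congr1 (@^~ z) (iter_deriveZ [:: u] (- D) _ (sXsum b)).
  have E3 := congr1 (@^~ z) (iter_derive_sum [:: u] _ (index_enum 'I_q)
    (fun l : 'I_q => (d < l)%N) _ (fun l _ => sXs b l)).
  have E4 l := congr1 (@^~ z) (iter_deriveZ [:: u] (sigma s l) _ (sX b l)).
  move: E1 E2 E3 E4; rewrite /= => E1 E2 E3 E4.
  rewrite /d_x -/u E1 E2 E3 mulNr; congr (_ - _ * _).
  by apply: eq_bigr => l _; rewrite E4.
rewrite mulr_sumr -addrA -sumrB; congr (d_t _ z + _).
  by apply/funext => y; rewrite mxE.
apply: eq_bigr => b _; rewrite -dG; congr (d_x b _ z); apply/funext => y.
by rewrite mulNr; congr (_ - _ * _); apply: eq_bigr => l _; rewrite /X thetaE.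
Qed.
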